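(* Assume that for every $\lambda\in\mathbb{R}^m$ the point $\bar z(\lambda)\in Z$ satisfies $$\min_{z\in Z}\langle \nabla\mathcal{L}_\rho(\bar z(\lambda),\lambda),\, z-\bar z(\lambda)\rangle \ge -\left(1+\sqrt{2L_{\mathrm p}}\,R_{\mathrm p}\right)\varepsilon_{\mathrm{in}} .$$ Let $\theta_0=1$, $\theta_{k+1}=\frac12\left(1+\sqrt{4\theta_k^2+1}\right)$, $S_k=\sum_{j=0}^k\theta_j$, $a_{k+1}=S_{k+1}^{-1}\theta_{k+1}$, and let $(\lambda_k)_{k\ge0}$, $(\mu_k)_{k\ge0}$ be generated from $\lambda_0\in\mathbb{R}^m$ by $$\mu_k=\lambda_k+L_{\mathrm d}^{-1}\nabla\bar d_\rho(\lambda_k),\qquad \lambda_{k+1}=(1-a_{k+1})\mu_k+a_{k+1}\Big[\lambda_0+L_{\mathrm d}^{-1}\sum_{i=0}^k\theta_i\nabla\bar d_\rho(\lambda_i)\Big].$$ Then for every $k\ge0$ $$f^*-d_\rho(\mu_k)\le\frac{2L_{\mathrm d}R_{\mathrm d}^2}{(k+1)(k+2)}+\frac{4(k+3)}{3}\left(1+\sqrt{2L_{\mathrm p}}\,R_{\mathrm p}\right)\varepsilon_{\mathrm{in}},$$ where $R_{\mathrm d}=\|\lambda_0-\lambda^*\|$.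
   Context: Setting: $f:\mathbb{R}^n\to\mathbb{R}$ is convex and differentiable, $A\in\mathbb{R}^{m\times n}$ has full row rank, $b\in\mathbb{R}^m$, $Z\subset\mathbb{R}^n$ is nonempty, compact and convex, $\rho>0$, $\varepsilon_{\mathrm{in}}>0$; $\|\cdot\|$ and $\langle\cdot,\cdot\rangle$ are the Euclidean norm and inner product. Primal problem: $f^*=\min\{f(z): Az=b,\ z\in Z\}$. Augmented Lagrangian: $\mathcal{L}_\rho(z,\lambda)=f(z)+\langle\lambda,Az-b\rangle+\frac\rho2\|Az-b\|^2$; $\nabla\mathcal{L}_\rho$ denotes its gradient in $z$, assumed Lipschitz continuous in $z$ on $\mathbb{R}^n$ with constant $L_{\mathrm p}>0$ for each $\lambda$. $R_{\mathrm p}=\max_{z,y\in Z}\|z-y\|$. Augmented dual function: $d_\rho(\lambda)=\min_{z\in Z}\mathcal{L}_\rho(z,\lambda)$. Slater's constraint qualification is assumed, so that $f^*=\max_{\lambda}\min_{z\in Z}\{f(z)+\langle\lambda,Az-b\rangle\}$; $\lambda^*$ denotes a maximizer of this dual problem (the ordinary dual and the problem $\max_\lambda d_\rho(\lambda)$ have the same optimal value and the same optimal solutions). $L_{\mathrm d}=1/\rho$. Inexact dual information: for each $\lambda$ an approximate minimizer $\bar z(\lambda)\in Z$ of $\mathcal{L}_\rho(\cdot,\lambda)$ over $Z$ is fixed, and $\nabla\bar d_\rho(\lambda):=A\bar z(\lambda)-b$ (a notation, not necessarily a gradient). *)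

(* Defs.v *)
From HB Require Import structures.
From mathcomp Require Import all_boot all_order all_algebra.
From mathcomp Require Import all_classical all_reals all_analysis.

Set Implicit Arguments.
Unset Strict Implicit.
Unset Printing Implicit Defensive.

Import Order.TTheory GRing.Theory Num.Theory.
Import numFieldNormedType.Exports.
Local Open Scope classical_set_scope.
Local Open Scope ring_scope.

(* The library norm on matrices is the sup norm. It induces the usual topology,
   so [compact], [differentiable] and neighbourhoods are the standard ones, but
   metric statements must use [enorm]. *)
Definition dot (R : realType) (n : nat) (u v : 'cV[R]_n) : R :=
  \sum_(i < n) u i 0 * v i 0.

Definition enorm (R : realType) (n : nat) (u : 'cV[R]_n) : R :=
  Num.sqrt (dot u u).

Definition grad (R : realType) (n : nat) (g : 'cV[R]_n -> R) (x : 'cV[R]_n) :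
  'cV[R]_n := \col_i 'D_(delta_mx i 0) g x.

Definition is_minimum (R : realType) (S : set R) (v : R) : Prop :=
  S v /\ lbound S v.

Definition is_maximum (R : realType) (S : set R) (v : R) : Prop :=
  S v /\ ubound S v.

(* Junk value 0 when the extremum is not attained; see [minimum_compact] and
   [maximum_compact]. *)
Definition minimum (R : realType) (S : set R) : R := xget 0 (is_minimum S).

Definition maximum (R : realType) (S : set R) : R := xget 0 (is_maximum S).

Definition affine_set (R : realType) (n : nat) (S : set 'cV[R]_n) : Prop :=
  forall x y (t : R), S x -> S y -> S (t *: x + (1 - t) *: y).

Definition affine_hull (R : realType) (n : nat) (S : set 'cV[R]_n) :
  set 'cV[R]_n := smallest (@affine_set R n) S.

Definition relint (R : realType) (n : nat) (S : set 'cV[R]_n) : set 'cV[R]_n :=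
  [set z | S z /\ \forall y \near z, affine_hull S y -> S y].

Definition slater (R : realType) (m n : nat) (A : 'M[R]_(m, n)) (b : 'cV[R]_m)
    (Z : set 'cV[R]_n) : Prop :=
  exists2 z, relint Z z & A *m z = b.

Definition optval (R : realType) (m n : nat) (f : 'cV[R]_n -> R)
    (A : 'M[R]_(m, n)) (b : 'cV[R]_m) (Z : set 'cV[R]_n) : R :=
  minimum [set f z | z in [set z | A *m z = b /\ Z z]].

Definition lagr (R : realType) (m n : nat) (f : 'cV[R]_n -> R)
    (A : 'M[R]_(m, n)) (b : 'cV[R]_m) (z : 'cV[R]_n) (l : 'cV[R]_m) : R :=
  f z + dot l (A *m z - b).

Definition auglagr (R : realType) (m n : nat) (f : 'cV[R]_n -> R)
    (A : 'M[R]_(m, n)) (b : 'cV[R]_m) (rho : R)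
    (z : 'cV[R]_n) (l : 'cV[R]_m) : R :=
  f z + dot l (A *m z - b) + rho / 2 * enorm (A *m z - b) ^+ 2.

Definition grad_auglagr (R : realType) (m n : nat) (f : 'cV[R]_n -> R)
    (A : 'M[R]_(m, n)) (b : 'cV[R]_m) (rho : R)
    (z : 'cV[R]_n) (l : 'cV[R]_m) : 'cV[R]_n :=
  grad (fun z' => auglagr f A b rho z' l) z.

Definition dual (R : realType) (m n : nat) (f : 'cV[R]_n -> R)
    (A : 'M[R]_(m, n)) (b : 'cV[R]_m) (Z : set 'cV[R]_n) (l : 'cV[R]_m) : R :=
  minimum [set lagr f A b z l | z in Z].

Definition augdual (R : realType) (m n : nat) (f : 'cV[R]_n -> R)
    (A : 'M[R]_(m, n)) (b : 'cV[R]_m) (Z : set 'cV[R]_n) (rho : R)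
    (l : 'cV[R]_m) : R :=
  minimum [set auglagr f A b rho z l | z in Z].

Definition dual_maximizer (R : realType) (m n : nat) (f : 'cV[R]_n -> R)
    (A : 'M[R]_(m, n)) (b : 'cV[R]_m) (Z : set 'cV[R]_n) (l : 'cV[R]_m) :
  Prop := forall l', dual f A b Z l' <= dual f A b Z l.

Definition ediam (R : realType) (n : nat) (Z : set 'cV[R]_n) : R :=
  maximum [set enorm (z - y) | z in Z & y in Z].

Definition Ld (R : realType) (rho : R) : R := 1 / rho.

Fixpoint theta (R : realType) (k : nat) : R :=
  if k is k'.+1 then 2^-1 * (1 + Num.sqrt (4 * theta R k' ^+ 2 + 1)) else 1.

Definition theta_sum (R : realType) (k : nat) : R :=
  \sum_(0 <= j < k.+1) theta R j.

Definition step (R : realType) (k : nat) : R := (theta_sum R k)^-1 * theta R k.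

Lemma minimumE (R : realType) (S : set R) (v : R) :
  is_minimum S v -> minimum S = v.
Proof.
move=> [Sv lv]; apply: xget_unique; first by split.
by move=> y [Sy ly]; apply/eqP; rewrite eq_le (ly _ Sv) (lv _ Sy).
Qed.

Lemma maximumE (R : realType) (S : set R) (v : R) :
  is_maximum S v -> maximum S = v.
Proof.
move=> [Sv uv]; apply: xget_unique; first by split.
by move=> y [Sy uy]; apply/eqP; rewrite eq_le (uv _ Sy) (uy _ Sv).
Qed.

Lemma minimum_compact (R : realType) (T : topologicalType) (g : T -> R)
    (Z : set T) :
  Z !=set0 -> compact Z -> {within Z, continuous g} ->
  is_minimum [set g z | z in Z] (minimum [set g z | z in Z]).
Proof.
move=> Z0 cZ cg; have [c /set_mem Zc cmin] := compact_EVT_min Z0 cZ cg.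
have h : is_minimum [set g z | z in Z] (g c).
  by split; [exists c|move=> _ [z Zz <-]; exact/cmin/mem_set].
by rewrite (minimumE h).
Qed.

Lemma maximum_compact (R : realType) (T : topologicalType) (g : T -> R)
    (Z : set T) :
  Z !=set0 -> compact Z -> {within Z, continuous g} ->
  is_maximum [set g z | z in Z] (maximum [set g z | z in Z]).
Proof.
move=> Z0 cZ cg; have [c /set_mem Zc cmax] := compact_EVT_max Z0 cZ cg.
have h : is_maximum [set g z | z in Z] (g c).
  by split; [exists c|move=> _ [z Zz <-]; exact/cmax/mem_set].
by rewrite (maximumE h).
Qed.

(* Main.v *)
(* By strong convexity of the augmented Lagrangian in [A z], an inexact minimizer
   at [l] yields a [(delta, 1/rho)]-oracle for the concave function [d_rho]: with
   [g = A zbar(l) - b] and [F] the augmented Lagrangian at [(zbar(l), l)],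
     [F + <g, x - l> - |x - l|^2 / (2 rho) - delta <= d_rho(x) <= F + <g, x - l>].
   The accelerated scheme then satisfies, with [S_k = theta_k^2] and [v_k] the
   dual-averaging point in the recursion for [lam],
     [S_k (f^* - d_rho(mu_k)) + |lstar - v_k|^2 / (2 rho)
        <= |lstar - lam_0|^2 / (2 rho) + (k + 1) S_k delta],
   and dividing by [S_k >= (k + 1)(k + 2) / 4] gives the rate. That the
   augmented Lagrangian at [lstar] is at least [f^*] on [Z] is strong duality,
   obtained by one proximal step from [lstar] in the dual. *)
Require Import Defs.
From HB Require Import structures.
From mathcomp Require Import all_boot all_order all_algebra.
From mathcomp Require Import all_classical all_reals all_analysis.
From mathcomp Require Import ring lra.

Set Implicit Arguments.
Unset Strict Implicit.
Unset Printing Implicit Defensive.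

Import Order.TTheory GRing.Theory Num.Theory.
Import numFieldNormedType.Exports.
Local Open Scope classical_set_scope.
Local Open Scope ring_scope.

(** * The Euclidean inner product *)

Lemma dotC (R : realType) (n : nat) (u v : 'cV[R]_n) : dot u v = dot v u.
Proof. by apply: eq_bigr => i _; rewrite mulrC. Qed.

Lemma dotDl (R : realType) (n : nat) (u v w : 'cV[R]_n) :
  dot (u + v) w = dot u w + dot v w.
Proof.
by rewrite /dot -big_split; apply: eq_bigr => i _; rewrite mxE mulrDl.
Qed.

Lemma dotZl (R : realType) (n : nat) (a : R) (u v : 'cV[R]_n) :
  dot (a *: u) v = a * dot u v.
Proof.
by rewrite /dot mulr_sumr; apply: eq_bigr => i _; rewrite mxE mulrA.
Qed.

Lemma dotNl (R : realType) (n : nat) (u v : 'cV[R]_n) :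
  dot (- u) v = - dot u v.
Proof. by rewrite -scaleN1r dotZl mulN1r. Qed.

Lemma dotDr (R : realType) (n : nat) (u v w : 'cV[R]_n) :
  dot w (u + v) = dot w u + dot w v.
Proof. by rewrite !(dotC w) dotDl. Qed.

Lemma dotZr (R : realType) (n : nat) (a : R) (u v : 'cV[R]_n) :
  dot v (a *: u) = a * dot v u.
Proof. by rewrite !(dotC v) dotZl. Qed.

Lemma dotNr (R : realType) (n : nat) (u v : 'cV[R]_n) :
  dot v (- u) = - dot v u.
Proof. by rewrite !(dotC v) dotNl. Qed.

Lemma dotv0 (R : realType) (n : nat) (u : 'cV[R]_n) : dot u 0 = 0.
Proof. by rewrite -(scale0r 0) dotZr mul0r. Qed.

Definition dotE := (dotDl, dotDr, dotNl, dotNr, dotZl, dotZr).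

Lemma dot_subZ (R : realType) (n : nat) (a : R) (u v : 'cV[R]_n) :
  dot (u - a *: v) (u - a *: v) =
  dot u u - 2 * a * dot v u + a ^+ 2 * dot v v.
Proof. by rewrite !dotE (dotC u v); ring. Qed.

Lemma dot_ge0 (R : realType) (n : nat) (u : 'cV[R]_n) : 0 <= dot u u.
Proof. by apply: sumr_ge0 => i _; rewrite -expr2 sqr_ge0. Qed.

Lemma dot_eq0 (R : realType) (n : nat) (u : 'cV[R]_n) : dot u u = 0 -> u = 0.
Proof.
move=> /eqP; rewrite psumr_eq0 => [/allP h|i _]; last by rewrite -expr2 sqr_ge0.
apply/colP => i; rewrite mxE; apply/eqP.
by have := h i (mem_index_enum _); rewrite /= mulf_eq0 orbb.
Qed.

Lemma enorm_sqr (R : realType) (n : nat) (u : 'cV[R]_n) :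
  enorm u ^+ 2 = dot u u.
Proof. by rewrite sqr_sqrtr ?dot_ge0. Qed.

(** * Differentiability of the augmented Lagrangian; gradients *)

Lemma differentiable_dot (R : realType) (m n : nat)
    (u v : 'cV[R]_n -> 'cV[R]_m) (x : 'cV[R]_n) :
  (forall i, differentiable (fun z => u z i 0) x) ->
  (forall i, differentiable (fun z => v z i 0) x) ->
  differentiable (fun z => dot (u z) (v z)) x.
Proof.
move=> du dv.
have -> : (fun z => dot (u z) (v z)) =
    \sum_(i < m) ((fun z => u z i 0) * (fun z => v z i 0)).
  by apply/funext => z; rewrite fct_sumE.
by apply: differentiable_sum => i; exact: differentiableM.
Qed.

Lemma differentiable_affine_coord (R : realType) (m n : nat)
    (A : 'M[R]_(m, n)) (b : 'cV[R]_m) (i : 'I_m) (x : 'cV[R]_n) :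
  differentiable (fun z : 'cV[R]_n => (A *m z - b) i 0) x.
Proof.
have -> : (fun z : 'cV[R]_n => (A *m z - b) i 0) =
    \sum_(j < n) (A i j *: (fun z : 'cV[R]_n => z j 0)) - cst (b i 0).
  by apply/funext => z; rewrite !mxE !fctE fct_sumE.
apply: differentiableB; last exact: differentiable_cst.
apply: differentiable_sum => j; apply: differentiableZ.
exact: differentiable_coord.
Qed.

Lemma differentiable_auglagr (R : realType) (m n : nat) (f : 'cV[R]_n -> R)
    (A : 'M[R]_(m, n)) (b : 'cV[R]_m) (rho : R) (l : 'cV[R]_m)
    (x : 'cV[R]_n) :
  differentiable f x ->
  differentiable (fun z => auglagr f A b rho z l) x.
Proof.
move=> df.
have -> : (fun z => auglagr f A b rho z l) =
    f + (fun z => dot l (A *m z - b)) +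
    (rho / 2) *: (fun z => dot (A *m z - b) (A *m z - b)).
  by apply/funext => z; rewrite /auglagr enorm_sqr.
apply: differentiableD; first apply: differentiableD => //.
  apply: (@differentiable_dot _ _ _ (fun=> l)) => i.
    exact: differentiable_cst.
  exact: differentiable_affine_coord.
apply: differentiableZ.
by apply: differentiable_dot => i; exact: differentiable_affine_coord.
Qed.

(** The differential is linear, so expanding [v] in the canonical basis reduces to the partial
    derivatives that define [grad]. *)
Lemma derive_grad (R : realType) (n : nat) (g : 'cV[R]_n -> R)
    (x v : 'cV[R]_n) :
  differentiable g x -> 'D_v g x = dot (grad g x) v.
Proof.
move=> dg; rewrite deriveE// [in LHS](matrix_sum_delta v) linear_sum.
apply: eq_bigr => i _; rewrite big_ord_recl big_ord0 addr0 linearZ /=.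
by rewrite mxE deriveE// mulrC [ord0](ord1 0).
Qed.

(** * Convexity along segments and first-order inequalities *)

(** [conv] takes weights in [{i01 R}]; this packs a real weight into that type. *)
Lemma i01_of_bounds (R : realType) (t : R) :
  0 <= t -> t <= 1 -> exists s : {i01 R}, s%:num = t.
Proof.
move=> t0 t1.
have t01 : Itv.spec (@Itv.num_sem R) (Itv.Real `[0%Z, 1%Z]) t.
  by rewrite /Itv.spec/= /Itv.num_sem/= num_real in_itv/= t0 t1.
by exists (Itv.mk t01).
Qed.

Lemma conv_segE (R : realType) (n : nat) (x y : 'cV[R]_n) (s : {i01 R}) :
  conv s (y : convex_lmodType _) (x : convex_lmodType _) =
  s%:num *: (y - x) + x.
Proof.
rewrite /conv /= scalerBl scale1r scalerBr.
by rewrite -addrA [- _ + x]addrC.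
Qed.

Lemma convex_function_seg (R : realType) (n : nat) (f : 'cV[R]_n -> R)
    (x y : 'cV[R]_n) (t : R) :
  convex_function [set: 'cV[R]_n] f -> 0 <= t -> t <= 1 ->
  f (t *: (y - x) + x) <= f x + t * (f y - f x).
Proof.
move=> cf t0 t1; have [s <-] := i01_of_bounds t0 t1.
have := cf s y x (mem_set I) (mem_set I).
rewrite conv_segE convRE => /le_trans; apply.
have -> : f x + s%:num * (f y - f x) = s%:num * f y + (1 - s%:num) * f x.
  by ring.
exact: lexx.
Qed.

Lemma convex_set_seg (R : realType) (n : nat) (Z : set 'cV[R]_n)
    (x y : 'cV[R]_n) (t : R) :
  convex_set Z -> Z x -> Z y -> 0 <= t -> t <= 1 -> Z (t *: (y - x) + x).
Proof.
move=> cZ Zx Zy t0 t1; have [s <-] := i01_of_bounds t0 t1.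
by have /set_mem := cZ y x s (mem_set Zy) (mem_set Zx); rewrite conv_segE.
Qed.

(** One-sided, since convexity controls [h *: (y - x) + x] only for [h] in [0, 1]. *)
Lemma cvg_derive_right (R : realType) (n : nat) (g : 'cV[R]_n -> R)
    (x v : 'cV[R]_n) :
  differentiable g x ->
  h^-1 * (g (h *: v + x) - g x) @[h --> 0^'+] --> dot (grad g x) v.
Proof.
move=> dg; rewrite -derive_grad//.
by apply: cvg_dnbhs_at_right; exact: (diff_derivable dg).
Qed.

Lemma grad_ge0_of_minimizer (R : realType) (n : nat) (g : 'cV[R]_n -> R)
    (Z : set 'cV[R]_n) (x y : 'cV[R]_n) :
  differentiable g x -> convex_set Z -> Z x -> Z y ->
  (forall z, Z z -> g x <= g z) -> 0 <= dot (grad g x) (y - x).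
Proof.
move=> dg cZ Zx Zy gmin.
apply: (cvgr_to_ge (cvg_derive_right (v := y - x) dg)).
near=> h.
have h0 : 0 < h by near: h; exact: nbhs_right_gt.
have h1 : h < 1 by near: h; exact: nbhs_right_lt.
rewrite mulr_ge0 ?invr_ge0 ?(ltW h0)// subr_ge0; apply: gmin.
by apply: convex_set_seg => //; exact: ltW.
Unshelve. all: by end_near. Qed.

(* The quadratic penalty makes the augmented Lagrangian strongly convex in the
   direction of [A z], which is what makes the dual smooth. *)
Lemma auglagr_seg (R : realType) (m n : nat) (f : 'cV[R]_n -> R)
    (A : 'M[R]_(m, n)) (b : 'cV[R]_m) (rho : R) (l : 'cV[R]_m)
    (x y : 'cV[R]_n) (t : R) :
  convex_function [set: 'cV[R]_n] f -> 0 <= t -> t <= 1 ->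
  auglagr f A b rho (t *: (y - x) + x) l <=
    auglagr f A b rho x l
    + t * (auglagr f A b rho y l - auglagr f A b rho x l
           - (1 - t) * (rho / 2 * dot (A *m (y - x)) (A *m (y - x)))).
Proof.
move=> cf t0 t1; have := convex_function_seg x y cf t0 t1.
rewrite /auglagr !enorm_sqr mulmxDr -scalemxAr !mulmxBr.
set p := A *m x; set q := A *m y.
rewrite !dotE (dotC q p) (dotC b p) (dotC b q) => H.
rewrite -subr_ge0 in H; rewrite -subr_ge0; apply: (le_trans H).
by rewrite le_eqVlt; apply/orP; left; apply/eqP; ring.
Qed.

(** Divide [auglagr_seg] by [t] and let [t] decrease to 0: the factor [1 - t] tends to 1 and the
    full quadratic term survives. *)
Lemma auglagr_grad_le (R : realType) (m n : nat) (f : 'cV[R]_n -> R)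
    (A : 'M[R]_(m, n)) (b : 'cV[R]_m) (rho : R) (l : 'cV[R]_m)
    (x y : 'cV[R]_n) :
  convex_function [set: 'cV[R]_n] f -> differentiable f x ->
  auglagr f A b rho x l + dot (grad_auglagr f A b rho x l) (y - x)
    + rho / 2 * dot (A *m (y - x)) (A *m (y - x))
  <= auglagr f A b rho y l.
Proof.
move=> cf df.
have dL := differentiable_auglagr A b rho l df.
set q := rho / 2 * _.
set D := auglagr f A b rho y l - auglagr f A b rho x l.
suff : dot (grad_auglagr f A b rho x l) (y - x) <= D - (1 - 0) * q.
  by rewrite /D; lra.
have cvr : D - (1 - h) * q @[h --> 0^'+] --> D - (1 - 0) * q.
  apply: cvgB; first exact: cvg_cst.
  apply: cvgM; last exact: cvg_cst.
  apply: cvgB; first exact: cvg_cst.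
  by apply: cvg_at_right_filter; exact: cvg_id.
apply: (ler_cvg_to (cvg_derive_right (v := y - x) dL) cvr).
near=> h.
have h0 : 0 < h by near: h; exact: nbhs_right_gt.
have h1 : h < 1 by near: h; exact: nbhs_right_lt.
rewrite ler_pdivrMl// lerBlDl.
exact: (auglagr_seg A b rho l x y cf (ltW h0) (ltW h1)).
Unshelve. all: by end_near. Qed.

(** * Attained minima and strong duality *)

Lemma minimum_differentiable (R : realType) (n : nat) (g : 'cV[R]_n -> R)
    (Z : set 'cV[R]_n) :
  Z !=set0 -> compact Z -> (forall x, differentiable g x) ->
  is_minimum [set g z | z in Z] (minimum [set g z | z in Z]).
Proof.
move=> Z0 cZ dg; apply: minimum_compact => //.
by apply: continuous_subspaceT => x; exact: differentiable_continuous.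
Qed.

Lemma minimum_le (R : realType) (n : nat) (g : 'cV[R]_n -> R)
    (Z : set 'cV[R]_n) (z : 'cV[R]_n) :
  compact Z -> (forall x, differentiable g x) -> Z z ->
  minimum [set g z | z in Z] <= g z.
Proof.
move=> cZ dg Zz.
have [_ lb] := minimum_differentiable (ex_intro _ z Zz) cZ dg.
by apply: lb; exists z.
Qed.

Lemma lagr_auglagr (R : realType) (m n : nat) (f : 'cV[R]_n -> R)
    (A : 'M[R]_(m, n)) (b : 'cV[R]_m) (z : 'cV[R]_n) (l : 'cV[R]_m) :
  lagr f A b z l = auglagr f A b 0 z l.
Proof. by rewrite /auglagr !mul0r addr0. Qed.

(* A minimizer [z] of the augmented Lagrangian (with [rho = 1]) at [lstar] also
   minimizes the ordinary Lagrangian at [lstar + (A z - b)], whose dual value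
   exceeds the one at [lstar] by at least [|A z - b|^2]; so the maximality of
   [lstar] makes [z] feasible. *)
Lemma strong_duality (R : realType) (m n : nat) (f : 'cV[R]_n -> R)
    (A : 'M[R]_(m, n)) (b : 'cV[R]_m) (Z : set 'cV[R]_n) (lstar : 'cV[R]_m) :
  convex_function [set: 'cV[R]_n] f -> (forall x, differentiable f x) ->
  Z !=set0 -> compact Z -> convex_set Z -> dual_maximizer f A b Z lstar ->
  optval f A b Z = dual f A b Z lstar.
Proof.
move=> cf df Z0 cZ cvZ lmax.
have dL r l x : differentiable (fun z => auglagr f A b r z l) x.
  exact: differentiable_auglagr.
have dual_le z l : Z z -> dual f A b Z l <= lagr f A b z l.
  move=> Zz; rewrite /dual; apply: minimum_le => // x.
  by under eq_fun do rewrite lagr_auglagr; exact: dL.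
have [[z Zz zval] zlb] := minimum_differentiable Z0 cZ (dL 1 lstar).
have zmin y : Z y -> auglagr f A b 1 z lstar <= auglagr f A b 1 y lstar.
  by move=> Zy; rewrite zval; apply: zlb; exists y.
pose l' := lstar + (A *m z - b).
have dual_l' : dual f A b Z l' = lagr f A b z l'.
  apply: minimumE; split; first by exists z.
  move=> _ [y Zy <-].
  (* Add the optimality condition at [z] to strong convexity: the squares of [A y - b] cancel, and
     the cross term moves the multiplier to [l']. *)
  have := grad_ge0_of_minimizer (dL 1 lstar z) cvZ Zz Zy zmin.
  have := auglagr_grad_le A b 1 lstar y cf (df z).
  rewrite /grad_auglagr /auglagr /lagr /l' !enorm_sqr mulmxBr.
  set p := A *m z; set q := A *m y; set G := grad _ _.
  have -> : q - p = (q - b) - (p - b) by rewrite opprB addrA subrK.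
  move: (p - b) (q - b) => p' q'.
  by rewrite !(dotDl, dotDr, dotNl, dotNr) (dotC q' p'); lra.
have feas : A *m z = b.
  apply/eqP; rewrite -subr_eq0; apply/eqP/dot_eq0/le_anti.
  rewrite dot_ge0 andbT.
  have := dual_le z lstar Zz; have := lmax l'; rewrite dual_l' /lagr /l' dotDl.
  lra.
have fz : f z = dual f A b Z lstar.
  apply/le_anti/andP; split.
    by have := lmax l'; rewrite dual_l' /lagr feas subrr dotv0 addr0.
  by have := dual_le z lstar Zz; rewrite /lagr feas subrr dotv0 addr0.
rewrite -fz; apply: minimumE; split; first by exists z.
move=> _ [y [Ay Zy] <-]; rewrite fz.
have := dual_le y lstar Zy; rewrite /lagr Ay subrr.
by rewrite dotv0 addr0.
Qed.

(** * The inexact oracle for the augmented dual *)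

(** The multiplier enters linearly, with the residual as slope. *)
Lemma auglagr_shift (R : realType) (m n : nat) (f : 'cV[R]_n -> R)
    (A : 'M[R]_(m, n)) (b : 'cV[R]_m) (rho : R) (z : 'cV[R]_n)
    (l l' : 'cV[R]_m) :
  auglagr f A b rho z l' =
  auglagr f A b rho z l + dot (A *m z - b) (l' - l).
Proof. by rewrite /auglagr (dotC _ (l' - l)) dotDl dotNl; ring. Qed.

Lemma augdual_le (R : realType) (m n : nat) (f : 'cV[R]_n -> R)
    (A : 'M[R]_(m, n)) (b : 'cV[R]_m) (Z : set 'cV[R]_n) (rho : R)
    (z : 'cV[R]_n) (l l' : 'cV[R]_m) :
  (forall x, differentiable f x) -> compact Z -> Z z ->
  augdual f A b Z rho l' <=
  auglagr f A b rho z l + dot (A *m z - b) (l' - l).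
Proof.
move=> df cZ Zz; rewrite -auglagr_shift; apply: minimum_le => // x.
exact: differentiable_auglagr.
Qed.

(** Compares [x] with an exact minimizer [z] at [l']; strong convexity in [A z] leaves a square that
    absorbs the cross term. *)
Lemma augdual_ge (R : realType) (m n : nat) (f : 'cV[R]_n -> R)
    (A : 'M[R]_(m, n)) (b : 'cV[R]_m) (Z : set 'cV[R]_n) (rho delta : R)
    (x : 'cV[R]_n) (l l' : 'cV[R]_m) :
  convex_function [set: 'cV[R]_n] f -> (forall x, differentiable f x) ->
  Z !=set0 -> compact Z -> 0 < rho ->
  (forall z, Z z -> - delta <= dot (grad_auglagr f A b rho x l) (z - x)) ->
  auglagr f A b rho x l + dot (A *m x - b) (l' - l)
    - rho^-1 / 2 * dot (l' - l) (l' - l) - delta <= augdual f A b Z rho l'.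
Proof.
move=> cf df Z0 cZ rho0 xdelta.
have dL y : differentiable (fun z => auglagr f A b rho z l') y.
  exact: differentiable_auglagr.
have [[z Zz zval] _] := minimum_differentiable Z0 cZ dL.
rewrite /augdual -zval (auglagr_shift f A b rho z l).
have := xdelta z Zz; have := auglagr_grad_le A b rho l z cf (df x).
have -> : A *m z - b = A *m (z - x) + (A *m x - b).
  by rewrite mulmxBr addrA subrK.
move: (A *m (z - x)) (A *m x - b) (l' - l) => w p e.
rewrite dotDl.
(* Young's inequality: <w, e> + rho/2 |w|^2 >= - |e|^2 / (2 rho). *)
have : 0 <= rho^-1 / 2 * dot (e - (- rho) *: w) (e - (- rho) *: w).
  by rewrite mulr_ge0 ?dot_ge0// divr_ge0// invr_ge0 ltW.
rewrite dot_subZ.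
have -> a c d : rho^-1 / 2 * (a - 2 * - rho * c + (- rho) ^+ 2 * d)
  = rho^-1 / 2 * a + c + rho / 2 * d by field; rewrite gt_eqF.
by lra.
Qed.

(** * The weights [theta] and the accelerated scheme *)

(** Each step adds at least 1/2, because sqrt (4 t^2 + 1) >= 2 t. *)
Lemma theta_ge (R : realType) (k : nat) : (k%:R + 2) / 2 <= theta R k.
Proof.
elim: k => [|k IH] /=; first by lra.
have k0 : 0 <= k%:R :> R by [].
set t := theta R k in IH *.
have : 2 * t <= Num.sqrt (4 * t ^+ 2 + 1).
  have -> : 2 * t = Num.sqrt ((2 * t) ^+ 2) by rewrite sqrtr_sqr ger0_norm//; lra.
  by apply: ler_wsqrtr; rewrite exprMn; lra.
by rewrite -[in k.+1%:R]addn1 natrD; lra.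
Qed.

Lemma theta_gt0 (R : realType) (k : nat) : 0 < theta R k.
Proof.
by have k0 : 0 <= k%:R :> R by []; have := theta_ge R k; lra.
Qed.

Lemma theta_sumS (R : realType) (k : nat) :
  theta_sum R k.+1 = theta_sum R k + theta R k.+1.
Proof. by rewrite /theta_sum big_nat_recr. Qed.

(** The next weight is the positive root of x^2 - x = theta_k^2, so the sum telescopes. *)
Lemma theta_sumE (R : realType) (k : nat) : theta_sum R k = theta R k ^+ 2.
Proof.
elim: k => [|k IH]; first by rewrite /theta_sum big_nat1 expr1n.
rewrite theta_sumS IH /=; set t := theta R k.
have : Num.sqrt (4 * t ^+ 2 + 1) ^+ 2 = 4 * t ^+ 2 + 1.
  by rewrite sqr_sqrtr//; have := sqr_ge0 t; lra.
by move: (Num.sqrt _) => s s2; rewrite exprMn sqrrD s2; field.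
Qed.

Lemma theta_sum_ge (R : realType) (k : nat) :
  (k%:R + 1) * (k%:R + 2) / 4 <= theta_sum R k.
Proof.
have k0 : 0 <= k%:R :> R by [].
by rewrite theta_sumE; have := theta_ge R k; nra.
Qed.

(* Telescoping form of the estimate-sequence argument: the weighted gap plus the
   squared distance from [lstar] to the dual-averaging point [v k] grows by at
   most [theta_sum * delta] per step. *)
Lemma fast_gradient_potential (R : realType) (m : nat) (rho delta dstar : R)
    (d : 'cV[R]_m -> R) (lstar : 'cV[R]_m) (F : nat -> R)
    (g lam mu v : nat -> 'cV[R]_m) :
  0 < rho -> 0 <= delta ->
  (forall k x, d x <= F k + dot (g k) (x - lam k)) ->
  (forall k, dstar <= F k + dot (g k) (lstar - lam k)) ->
  (forall k x, F k + dot (g k) (x - lam k)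
     - rho^-1 / 2 * dot (x - lam k) (x - lam k) - delta <= d x) ->
  (forall k, mu k = lam k + rho *: g k) ->
  (forall k, lam k.+1 = (1 - step R k.+1) *: mu k + step R k.+1 *: v k) ->
  v 0%N = mu 0%N ->
  (forall k, v k.+1 = v k + (rho * theta R k.+1) *: g k.+1) ->
  forall k, theta_sum R k * (dstar - d (mu k))
      + rho^-1 / 2 * dot (lstar - v k) (lstar - v k)
    <= rho^-1 / 2 * dot (lstar - lam 0%N) (lstar - lam 0%N)
       + k.+1%:R * theta_sum R k * delta.
Proof.
move=> rho0 delta0 dup starup dlow muE lamS v0 vS.
have rhoN : rho != 0 by rewrite gt_eqF.
(* [mu k] maximizes the quadratic lower bound at [lam k]. *)
have dmu k : F k + rho / 2 * dot (g k) (g k) - delta <= d (mu k).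
  have := dlow k (mu k).
  have -> : mu k - lam k = rho *: g k by rewrite muE addrAC subrr add0r.
  rewrite !dotE.
  set q := dot _ _.
  have -> : rho^-1 / 2 * (rho * (rho * q)) = rho / 2 * q by field.
  by lra.
elim=> [|k IH].
  rewrite v0 /theta_sum big_nat1 /= mul1r !mulr1n mul1r.
  have := dmu 0%N; have := starup 0%N; rewrite muE.
  have -> : lstar - (lam 0%N + rho *: g 0%N) =
     (lstar - lam 0%N) - rho *: g 0%N by rewrite opprD addrA.
  move: (lstar - lam 0%N) (g 0%N) => x h.
  rewrite dot_subZ.
  have -> a c e : rho^-1 / 2 * (a - 2 * rho * c + rho ^+ 2 * e)
    = rho^-1 / 2 * a - c + rho / 2 * e by field.
  by lra.
set S := theta_sum R k; set S' := theta_sum R k.+1; set t := theta R k.+1.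
have S'E : S' = S + t by exact: theta_sumS.
have S't : S' = t ^+ 2 by exact: theta_sumE.
have t0 : 0 < t by exact: theta_gt0.
have S0 : 0 < S by rewrite /S theta_sumE exprn_gt0// theta_gt0.
(* [lam k.+1] is the barycenter of [mu k] and [v k] with weights [S] and [t],
   which is what combines the two linear terms. *)
have bary : S *: (mu k - lam k.+1) + t *: (lstar - lam k.+1) =
    t *: (lstar - v k).
  have -> : lam k.+1 = S'^-1 *: (S *: mu k + t *: v k).
    rewrite lamS scalerDr !scalerA /step -/S' -/t; congr (_ *: _ + _ *: _).
    by rewrite S'E; field; lra.
  apply: (@scalerI _ _ S'); first by rewrite S'E; lra.
  rewrite !scalerDr !scalerN !scalerA.
  by apply/colP => i; rewrite !mxE S'E; field; lra.
have lin : S * dot (g k.+1) (mu k - lam k.+1)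
    + t * dot (g k.+1) (lstar - lam k.+1) = t * dot (g k.+1) (lstar - v k).
  by rewrite -!dotZr -dotDr bary.
(* The upper bounds at [mu k] and [lstar] get weights [S] and [t], so that [lin] merges their
   slopes; the lower bound at [mu k.+1] gets weight [S']. *)
have h1 : S * d (mu k) <= S * (F k.+1 + dot (g k.+1) (mu k - lam k.+1)).
  by rewrite ler_pM2l.
have h2 : t * dstar <= t * (F k.+1 + dot (g k.+1) (lstar - lam k.+1)).
  by rewrite ler_pM2l.
have h3 : S' * (F k.+1 + rho / 2 * dot (g k.+1) (g k.+1) - delta)
    <= S' * d (mu k.+1).
  by rewrite ler_pM2l// S'E addr_gt0.
(* Error accumulation, using [S <= S']. *)
have h4 : k.+1%:R * S * delta + S' * delta <= k.+2%:R * S' * delta.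
  rewrite -mulrDl ler_wpM2r// -[k.+2]addn1 natrD mulrDl mul1r lerD2r.
  by rewrite ler_wpM2l// S'E; lra.
rewrite vS -/t.
have -> : lstar - (v k + (rho * t) *: g k.+1) =
     (lstar - v k) - (rho * t) *: g k.+1 by rewrite opprD addrA.
move: IH lin; rewrite -/S; set x := lstar - v k; move: h1 h2 h3; clearbody x.
move: (F k.+1) (d (mu k)) (d (mu k.+1)) (dot _ (mu k - _)) (dot _ (lstar - _)).
move=> Fk dk dk1 p q h1 h2 h3 IH lin.
rewrite dot_subZ.
have -> a c e : rho^-1 / 2 * (a - 2 * (rho * t) * c + (rho * t) ^+ 2 * e)
  = rho^-1 / 2 * a - t * c + rho / 2 * (t ^+ 2 * e) by field.
(* By S' = t^2 the gain in [h3] cancels the quadratic term of the expanded square. *)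
rewrite -S't; move: h1 h2 h3 h4 IH lin; rewrite S'E.
lra.
Qed.

(** * The convergence rate *)

Theorem theorem3p6 (R : realType) (m n : nat)
    (f : 'cV[R]_n -> R) (A : 'M[R]_(m, n)) (b : 'cV[R]_m) (Z : set 'cV[R]_n)
    (rho eps_in Lp : R)
    (f_convex : convex_function [set: 'cV[R]_n] f)
    (f_diff : forall x : 'cV[R]_n, differentiable f x)
    (A_full_row_rank : \rank A = m)
    (Z_nonempty : Z !=set0) (Z_compact : compact Z) (Z_convex : convex_set Z)
    (rho_gt0 : 0 < rho) (eps_in_gt0 : 0 < eps_in) (Lp_gt0 : 0 < Lp)
    (grad_lipschitz : forall (l : 'cV[R]_m) (x y : 'cV[R]_n),
      enorm (grad_auglagr f A b rho x l - grad_auglagr f A b rho y l)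
        <= Lp * enorm (x - y))
    (slater_cq : slater A b Z)
    (lstar : 'cV[R]_m) (lstar_opt : dual_maximizer f A b Z lstar)
    (zbar : 'cV[R]_m -> 'cV[R]_n)
    (zbar_in : forall l : 'cV[R]_m, Z (zbar l))
    (zbar_inexact : forall l : 'cV[R]_m,
      minimum [set dot (grad_auglagr f A b rho (zbar l) l) (z - zbar l)
              | z in Z]
        >= - ((1 + Num.sqrt (2 * Lp) * ediam Z) * eps_in))
    (lam mu : nat -> 'cV[R]_m)
    (mu_def : forall k : nat,
      mu k = lam k + (Ld rho)^-1 *: (A *m zbar (lam k) - b))
    (lam_rec : forall k : nat,
      lam k.+1 = (1 - step R k.+1) *: mu k
        + step R k.+1 *:
          (lam 0%N + (Ld rho)^-1 *:
             \sum_(0 <= i < k.+1) theta R i *: (A *m zbar (lam i) - b))) :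
  forall k : nat,
    optval f A b Z - augdual f A b Z rho (mu k)
      <= 2 * Ld rho * enorm (lam 0%N - lstar) ^+ 2
           / ((k%:R + 1) * (k%:R + 2))
         + 4 * (k%:R + 3) / 3
           * ((1 + Num.sqrt (2 * Lp) * ediam Z) * eps_in).
Proof.
set delta := (1 + _) * eps_in => k.
have LdE : Ld rho = rho^-1 by rewrite /Ld div1r.
have LdV : (Ld rho)^-1 = rho by rewrite LdE invrK.
have zbar_delta l z : Z z ->
    - delta <= dot (grad_auglagr f A b rho (zbar l) l) (z - zbar l).
  move=> Zz; apply: le_trans (zbar_inexact l) _.
  apply: (@minimum_le _ _ (fun z => dot _ (z - zbar l))) => // x.
  apply: (@differentiable_dot _ _ _ (fun=> _)) => i.
    exact: differentiable_cst.
  (* The identity matrix puts [z - zbar l] in the affine form [A *m z - b]. *)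
  under eq_fun do rewrite -[z in z - _]mul1mx.
  exact: differentiable_affine_coord.
have delta0 : 0 <= delta.
  (* Test the inexactness condition at [zbar 0] itself. *)
  by have := zbar_delta 0 _ (zbar_in 0); rewrite subrr dotv0; lra.
pose g i := A *m zbar (lam i) - b.
pose v i := lam 0%N + rho *: \sum_(0 <= j < i.+1) theta R j *: g j.
pose F i := auglagr f A b rho (zbar (lam i)) (lam i).
have star_le i : optval f A b Z <= F i + dot (g i) (lstar - lam i).
  rewrite (strong_duality f_convex f_diff Z_nonempty Z_compact Z_convex
    lstar_opt).
  (* The right side is the augmented Lagrangian at [lstar], which dominates the ordinary one. *)
  rewrite -auglagr_shift; set z := zbar _.
  apply: (@le_trans _ _ (lagr f A b z lstar)).
    apply: minimum_le => // [x|]; last exact: zbar_in.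
    under eq_fun do rewrite lagr_auglagr.
    exact: differentiable_auglagr.
  by rewrite /lagr /auglagr lerDl mulr_ge0 ?sqr_ge0// divr_ge0// ltW.
have pot : theta_sum R k * (optval f A b Z - augdual f A b Z rho (mu k))
      + rho^-1 / 2 * dot (lstar - v k) (lstar - v k)
    <= rho^-1 / 2 * dot (lstar - lam 0%N) (lstar - lam 0%N)
       + k.+1%:R * theta_sum R k * delta.
  apply: (fast_gradient_potential (F := F) (g := g)) => // [i x|i x|i|i||i].
  - exact: augdual_le.
  - by apply: augdual_ge => // z; exact: zbar_delta.
  - by rewrite mu_def LdV.
  - by rewrite lam_rec LdV.
  - by rewrite /v big_nat1 /= scale1r mu_def LdV.
  - by rewrite /v [in LHS]big_nat_recr//= scalerDr scalerA addrA.
have q0 : 0 <= rho^-1 / 2 * dot (lstar - v k) (lstar - v k).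
  by rewrite mulr_ge0 ?dot_ge0// divr_ge0// invr_ge0 ltW.
have k0 : 0 <= k%:R :> R by [].
have P0 : 0 < (k%:R + 1) * (k%:R + 2) :> R by rewrite mulr_gt0//; lra.
have SP := theta_sum_ge R k.
have S0 : 0 < theta_sum R k by lra.
rewrite LdE enorm_sqr -[lam 0%N - lstar]opprB dotNl dotNr opprK.
set c := dot (lstar - lam 0%N) _ in pot *.
have X0 : 0 <= rho^-1 / 2 * c.
  by rewrite mulr_ge0 ?dot_ge0// divr_ge0// invr_ge0 ltW.
rewrite -[k.+1]addn1 natrD in pot.
apply: (@le_trans _ _ (rho^-1 / 2 * c / theta_sum R k + (k%:R + 1) * delta)).
  rewrite -(ler_pM2l S0) [leRHS]mulrDr.
  have -> : theta_sum R k * (rho^-1 / 2 * c / theta_sum R k) = rho^-1 / 2 * c.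
    by rewrite mulrC divfK// gt_eqF.
  by lra.
(* The error term only needs k + 1 <= 4 (k + 3) / 3. *)
apply: lerD; last by rewrite ler_wpM2r//; lra.
rewrite ler_pdivrMr// [leRHS]mulrAC ler_pdivlMr//.
by move: X0 SP; set P := _ * (k%:R + 2); nra.
Qed.
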